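(* There exist constants $C,\varepsilon_0>0$ such that for every fixed $\varepsilon\in(0,\varepsilon_0)$ and $p=\frac{1+\varepsilon}{n}$ the following holds with high probability: the graph $G\sim\mathcal{G}(n,p)$ does not contain a set of vertex disjoint paths, each of length at least $\frac{C}{\varepsilon}\ln\left(\frac{1}{\varepsilon}\right)$, whose union covers at least $13\varepsilon^2 n$ vertices.
   Context: $\mathcal{G}(n,p)$ is the binomial random graph on vertex set $[n]=\{1,\dots,n\}$: each pair of vertices forms an edge independently with probability $p$. ''With high probability'' means with probability tending to $1$ as $n\to\infty$ (with $\varepsilon$ fixed). The length of a path is its number of edges. *)

(* Defs.v *)
From HB Require Import structures.
From mathcomp Require Import all_boot all_order all_algebra.
From mathcomp Require Import all_classical all_reals all_analysis.
Import Order.TTheory GRing.Theory Num.Theory.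
Import numFieldNormedType.Exports.

Set Implicit Arguments.
Unset Strict Implicit.
Unset Printing Implicit Defensive.

Local Open Scope ring_scope.

(* The vertex set [n] is 'I_n (labels shifted by one). *)
Definition vpair (n : nat) := {e : {set 'I_n} | #|e| == 2%N}.

(* A simple graph on [n] is determined by its edge set. *)
Definition sgraph (n : nat) := {set vpair n}.

(* No loops: [set u; u] has one element. *)
Definition adj (n : nat) (G : sgraph n) : rel 'I_n :=
  fun u v => [exists e in G, val e == [set u; v]%SET].

Lemma adj_sym (n : nat) (G : sgraph n) : symmetric (adj G).
Proof. by move=> u v; rewrite /adj; apply: eq_existsb => e; rewrite finset.setUC. Qed.

Lemma adj_irr (n : nat) (G : sgraph n) : irreflexive (adj G).
Proof.
move=> u; apply/existsP => -[e /andP[_ /eqP eu]].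
by have := valP e; rewrite eu finset.setUid cards1.
Qed.

(* The law of G(n,p). It is a probability only for 0 <= p <= 1; with
   p = (1 + eps) / n this holds for all n >= 1 + eps. *)
Definition gnp_mass (R : realType) (n : nat) (p : R) (G : sgraph n) : R :=
  \prod_(e : vpair n) (if e \in G then p else 1 - p).

Definition gnp_prob (R : realType) (n : nat) (p : R) (A : sgraph n -> Prop) : R :=
  \sum_(G : sgraph n | `[< A G >]) gnp_mass p G.

Lemma gnp_mass_ge0 (R : realType) (n : nat) (p : R) (G : sgraph n) :
  0 <= p <= 1 -> 0 <= gnp_mass p G.
Proof.
move=> /andP[p0 p1]; apply: prodr_ge0 => e _.
by case: ifP => // _; rewrite subr_ge0.
Qed.

(* Mutual independence of the edge indicators; S = set0 gives total mass 1. *)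
Lemma gnp_prob_edges (R : realType) (n : nat) (p : R) (S : {set vpair n}) :
  gnp_prob p (fun G : sgraph n => S \subset G) = p ^+ #|S|.
Proof.
transitivity (\prod_(e : vpair n) (p + (if e \in S then 0 else 1 - p))).
  rewrite bigA_distr /gnp_prob big_mkcond /=; apply: eq_bigr => G _.
  rewrite asboolb; case: ifPn => [/fintype.subsetP SG|/fintype.subsetPn[e eS eG]].
    apply: eq_bigr => e _; case: ifPn => // eG; case: ifPn => // /SG.
    by rewrite (negbTE eG).
  by rewrite (bigD1 e) //= (negbTE eG) eS mul0r.
rewrite -prodr_const [RHS]big_mkcond; apply: eq_bigr => e _.
by case: ifP => _; rewrite ?addr0 // addrC subrK.
Qed.

(* A path is given by its nonempty sequence of distinct vertices. *)
Definition is_path (n : nat) (G : sgraph n) (s : seq 'I_n) : bool :=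
  [&& s != [::], uniq s & sorted (adj G) s].

(* Number of edges. *)
Definition path_length (n : nat) (s : seq 'I_n) : nat := (size s).-1.

(* As paths are nonempty, the members of a pairwise disjoint family are
   automatically distinct, so a sequence faithfully encodes a set of paths. *)
Definition disjoint_paths (n : nat) (G : sgraph n) (F : seq (seq 'I_n)) : bool :=
  all (is_path G) F && pairwise (fun s t => [disjoint s & t]) F.

Definition covered_vertices (n : nat) (F : seq (seq 'I_n)) : {set 'I_n} :=
  [set v | has (fun s : seq 'I_n => v \in s) F]%SET.

Definition long_paths_cover (R : realType) (n : nat) (G : sgraph n) (l m : R) : Prop :=
  exists F : seq (seq 'I_n),
    [/\ disjoint_paths G F,
        forall s, s \in F -> l <= (path_length s)%:R
      & m <= #|covered_vertices F|%:R].

(* G ~ G(n, p n) has property A n with high probability. *)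
Definition gnp_whp (R : realType) (p : nat -> R)
    (A : forall n : nat, sgraph n -> Prop) : Prop :=
  (gnp_prob (p n) (A n) @[n --> \oo] --> (1 : R))%classic.

(* Main.v *)
(* Put h = floor(1/eps). A vertex of a path that is at distance more than h from
   both ends of the path is a fork: it has two distinct neighbours from each of
   which a path of length h starts that avoids it. As h eps <= 1, all but a small
   fraction of the vertices of a path of length at least (C/eps) ln(1/eps) are
   forks, so it suffices to have fewer than 12 eps^2 n forks with high probability.
   - A path of length h starts at a given vertex with probability q_h <= 4/(h+1):
     revealing the edges at v after the rest of the graph and using the concavity
     of y / (1 - p/2 + y/2), a bound for 1 - (1-p)^m at y = p m, gives
     1/q_(h+1) >= (1-eps)/q_h + 1/2.
   - Hence a vertex is a fork with probability at most
     p^2/2 * (4 eps n)^2 + O(1/n) < 10 eps^2 + O(1/n).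
   - The number of forks has variance O(n) by the Efron-Stein inequality, as
     flipping one pair only affects the vertices within distance h+1 of it. *)
Require Import Defs.
From mathcomp Require Import all_boot all_order all_algebra.
From mathcomp Require Import all_classical all_reals all_analysis.
From mathcomp Require Import lra zify.
Import Order.TTheory GRing.Theory Num.Theory.
Import numFieldNormedType.Exports.

Set Implicit Arguments.
Unset Strict Implicit.
Unset Printing Implicit Defensive.

Local Open Scope ring_scope.

(** * Random subsets of a finite set: expectation, averaging and variance *)

Section Bernoulli.
Variables (R : realFieldType) (T : finType) (p : R).
Implicit Types (f g : {set T} -> R) (G : {set T}) (e : T) (s : seq T).

Definition weight G : R := \prod_(e : T) (if e \in G then p else 1 - p).

Definition expect f : R := \sum_(G : {set T}) weight G * f G.

(** The conditional expectation of [f] given all coordinates other than [e]. *)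
Definition avg e f : {set T} -> R :=
  fun G => p * f (e |: G)%SET + (1 - p) * f (G :\ e)%SET.

Definition influence e f : {set T} -> R := fun G => f (e |: G)%SET - f (G :\ e)%SET.

Definition free_of e f := forall G, f (e |: G)%SET = f (G :\ e)%SET.

Lemma weight_total : \sum_(G : {set T}) weight G = 1.
Proof.
transitivity (\prod_(e : T) (p + (1 - p))).
  by rewrite bigA_distr.
by rewrite big1 // => e _; rewrite addrC subrK.
Qed.

Lemma eq_expect f g : f =1 g -> expect f = expect g.
Proof. by move=> fg; apply: eq_bigr => G _; rewrite fg. Qed.

Lemma expectD f g : expect (fun G => f G + g G) = expect f + expect g.
Proof. by rewrite -big_split; apply: eq_bigr => G _; rewrite mulrDr. Qed.

Lemma expectZ c f : expect (fun G => c * f G) = c * expect f.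
Proof. by rewrite mulr_sumr; apply: eq_bigr => G _; rewrite mulrCA. Qed.

Lemma expectB f g : expect (fun G => f G - g G) = expect f - expect g.
Proof. by rewrite -sumrB; apply: eq_bigr => G _; rewrite mulrBr. Qed.

Lemma expect_cst c : expect (fun=> c) = c.
Proof. by rewrite /expect -mulr_suml weight_total mul1r. Qed.

Lemma expect_sum (I : finType) (P : pred I) (F : I -> {set T} -> R) :
  expect (fun G => \sum_(i | P i) F i G) = \sum_(i | P i) expect (F i).
Proof.
by rewrite exchange_big; apply: eq_bigr => G _; rewrite mulr_sumr.
Qed.

Lemma expect_avg e f : expect (avg e f) = expect f.
Proof.
(* Pairing each [G] without [e] with [e |: G] takes the factor of the coordinate [e] out of the
   weight. *)
have split_e g : expect g = \sum_(G : {set T} | e \notin G)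
    (\prod_(x | x != e) (if x \in G then p else 1 - p)) *
    (p * g (e |: G)%SET + (1 - p) * g G).
  rewrite /expect (bigID (fun G : {set T} => e \in G)) /= addrC.
  rewrite [X in _ + X](reindex_onto (fun G => e |: G)%SET (fun G => G :\ e)%SET) /=;
    last by move=> G eG; rewrite finset.setD1K.
  rewrite [X in _ + X](eq_bigl (fun G : {set T} => e \notin G)); last first.
    move=> G; rewrite finset.setU11 /=; apply/eqP/idP => [<-|eG].
      by rewrite !inE eqxx.
    by rewrite finset.setU1K.
  rewrite -big_split /=; apply: eq_bigr => G eG.
  rewrite /weight !(bigD1 e (P := xpredT)) //= finset.setU11 (negbTE eG).
  rewrite (eq_bigr (fun x => if x \in G then p else 1 - p) (P := fun x => x != e)
     (F1 := fun x => if x \in e |: G then p else 1 - p)%SET); last first.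
    by move=> x /negbTE xe; rewrite !inE xe.
  by lra.
rewrite !split_e; apply: eq_bigr => G eG; congr (_ * _).
rewrite /avg finset.setU1K // finset.setUA finset.setUid.
have -> : (G :\ e = G)%SET by apply/finset.setDidPl; rewrite disjoint_sym disjoints1.
by lra.
Qed.

Lemma free_ofP e f : free_of e f -> f =1 fun G => f (G :\ e)%SET.
Proof.
move=> fe G; rewrite -fe; have [eG|eG] := boolP (e \in G).
  by congr f; apply/esym/finset.setUidPr; rewrite finset.sub1set.
by rewrite fe; congr f; apply/esym/finset.setDidPl; rewrite disjoint_sym disjoints1.
Qed.

Lemma free_ofU e f : free_of e f -> f =1 fun G => f (e |: G)%SET.
Proof. by move=> fe G; rewrite fe; exact: free_ofP. Qed.

Lemma free_of_mul e f g :
  free_of e f -> free_of e g -> free_of e (fun G => f G * g G).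
Proof. by move=> fe ge G; rewrite fe ge. Qed.

Lemma free_of_mem e e' : e' != e -> free_of e (fun G => (e' \in G)%:R).
Proof. by move=> ee' G; rewrite !inE (negbTE ee'). Qed.

Lemma expect_mem e f : free_of e f ->
  expect (fun G => (e \in G)%:R * f G) = p * expect f.
Proof.
move=> fe; rewrite -(expect_avg e) -expectZ; apply: eq_expect => G.
by rewrite /avg !inE eqxx /= -fe -(free_ofU fe); lra.
Qed.

Lemma expect_mem2 e e' f : e != e' -> free_of e f -> free_of e' f ->
  expect (fun G => (e \in G)%:R * ((e' \in G)%:R * f G)) = p ^+ 2 * expect f.
Proof.
move=> ee' fe fe'; rewrite expect_mem ?expect_mem //; first by lra.
by apply: free_of_mul => //; apply: free_of_mem; rewrite eq_sym.
Qed.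

(** The coordinates of [W] are averaged out one at a time: the sets containing [e] contribute
    nothing, the others a factor [1 - p], and [f] is not affected. *)
Lemma expect_disjoint (W : {set T}) f : {in W, forall e, free_of e f} ->
  expect (fun G => [disjoint W & G]%:R * f G) = (1 - p) ^+ #|W| * expect f.
Proof.
have [k] := ubnP #|W|; elim: k W => // k IH W; rewrite ltnS => Wk fW.
have [->|[e eW]] := set_0Vmem W.
  rewrite cards0 expr0 mul1r; apply: eq_expect => G.
  by rewrite -finset.setI_eq0 finset.set0I eqxx mul1r.
have We : (#|W :\ e| < k)%N.
  by apply: leq_trans Wk; rewrite [in X in (_ < X)%N](cardsD1 e) eW.
rewrite (cardsD1 e) eW add1n exprS -mulrA -IH //; last first.
  by move=> x /setD1P[_ /fW].
rewrite -expectZ -(expect_avg e); apply: eq_expect => G.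
have fe := fW _ eW; rewrite /avg -(fe G) -(free_ofU fe).
have -> : [disjoint W & e |: G]%SET = false.
  by apply/negP => /pred0P/(_ e); rewrite /= !inE eqxx eW.
rewrite mul0r mulr0 add0r; congr (_ * (_ * _)); congr (nat_of_bool _)%:R.
by rewrite -!finset.setI_eq0 finset.setIDA finset.setIDAC.
Qed.

Hypothesis p01 : 0 <= p <= 1.

Lemma weight_ge0 G : 0 <= weight G.
Proof.
case/andP: p01 => p0 p1; apply: prodr_ge0 => e _.
by case: ifP => // _; rewrite subr_ge0.
Qed.

Lemma le_expect f g : (forall G, f G <= g G) -> expect f <= expect g.
Proof. by move=> fg; apply: ler_sum => G _; rewrite ler_wpM2l ?weight_ge0. Qed.

Lemma expect_ge0 f : (forall G, 0 <= f G) -> 0 <= expect f.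
Proof. by move=> f0; rewrite -(expect_cst 0); exact: le_expect. Qed.

Lemma chebyshev_expect f (t : R) : expect f < t ->
  expect (fun G => (t <= f G)%R%:R) <=
    (expect (fun G => f G ^+ 2) - expect f ^+ 2) / (t - expect f) ^+ 2.
Proof.
set m := expect f => mt; rewrite ler_pdivlMr ?exprn_gt0 ?subr_gt0 //.
have -> : expect (fun G => f G ^+ 2) - m ^+ 2 = expect (fun G => (f G - m) ^+ 2).
  rewrite [RHS](eq_expect (g := fun G => f G ^+ 2 - (2 * m * f G - m ^+ 2))).
    by rewrite !expectB expectZ expect_cst -/m; lra.
  by move=> G; lra.
rewrite mulrC -expectZ; apply: le_expect => G.
have [tf|_] := boolP (t <= f G); last by rewrite mulr0 sqr_ge0.
by rewrite mulr1 lerXn2r ?nnegrE ?subr_ge0 ?(ltW mt) ?lerB // (le_trans (ltW mt)).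
Qed.

Definition avgs s f := foldr avg f s.

Lemma expect_avgs s f : expect (avgs s f) = expect f.
Proof. by elim: s => //= e s <-; exact: expect_avg. Qed.

Lemma influence_avgs e s f : e \notin s -> influence e (avgs s f) =1 avgs s (influence e f).
Proof.
elim: s => //= e' s IH; rewrite inE negb_or => /andP[ee' /IH {}IH] G.
rewrite {2}/avg -!IH /influence /avg.
have -> : (e' |: (e |: G) = e |: (e' |: G))%SET by rewrite finset.setUCA.
have -> : ((e |: G) :\ e' = e |: (G :\ e'))%SET.
  apply/finset.setP => x; rewrite !inE; case: eqVneq => // ->.
  by rewrite eq_sym (negbTE ee').
have -> : (e' |: (G :\ e) = (e' |: G) :\ e)%SET.
  apply/finset.setP => x; rewrite !inE; case: (x =P e') => // ->.
  by rewrite eq_sym ee'.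
have -> : ((G :\ e) :\ e' = (G :\ e') :\ e)%SET by rewrite finset.setDDl finset.setUC -finset.setDDl.
by lra.
Qed.

(** Given the other coordinates, [f] takes two values, with probabilities [p] and [1 - p]; this is
    the variance of such a variable. *)
Lemma avg_sqr e f G :
  avg e (fun H => f H ^+ 2) G - avg e f G ^+ 2 = p * (1 - p) * influence e f G ^+ 2.
Proof. by rewrite /avg /influence; lra. Qed.

(** Each averaging contracts the second moment, because the conditional variance in [avg_sqr] is
    nonnegative. *)
Lemma expect_avgs_sqr s f :
  expect (fun G => avgs s f G ^+ 2) <= expect (fun G => f G ^+ 2).
Proof.
elim: s => //= e s; apply: le_trans; rewrite -[leRHS](expect_avg e).
apply: le_expect => G; rewrite -subr_ge0 avg_sqr.
by case/andP: p01 => p0 p1; rewrite mulr_ge0 ?sqr_ge0 // mulr_ge0 ?subr_ge0.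
Qed.

Lemma avgs_free e s f : e \in s -> free_of e (avgs s f).
Proof.
elim: s => //= e' s IH; rewrite inE => /orP[/eqP <-|/IH {}IH] G.
  rewrite /avg; congr (_ * avgs s f _ + _ * avgs s f _);
  by apply/finset.setP => x; rewrite !inE; case: eqVneq.
have [->|ee'] := eqVneq e e'.
  rewrite /avg; congr (_ * avgs s f _ + _ * avgs s f _);
  by apply/finset.setP => x; rewrite !inE; case: eqVneq.
rewrite /avg; congr (_ * _ + _ * _).
  rewrite finset.setUCA IH; congr avgs.
  apply/finset.setP => x; rewrite !inE; case: (x =P e') => // ->.
  by rewrite eq_sym ee'.
transitivity (avgs s f (e |: (G :\ e'))%SET).
  congr avgs; apply/finset.setP => x; rewrite !inE; case: eqVneq => // ->.
  by rewrite eq_sym (negbTE ee').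
by rewrite IH finset.setDDl finset.setUC -finset.setDDl.
Qed.

(** Once every coordinate is averaged out the value no longer depends on [G], so it equals its own
    mean, which averaging preserves. *)
Lemma avgs_enum f G : avgs (enum T) f G = expect f.
Proof.
set g := avgs _ _; have g0 H : g H = g finset.set0.
  have [k] := ubnP #|H|; elim: k H => // k IH H; rewrite ltnS => Hk.
  have [->//|[e eH]] := set_0Vmem H.
  have -> : g H = g (H :\ e)%SET.
    by apply: free_ofP; apply: avgs_free; rewrite mem_enum.
  by apply: IH; apply: leq_trans Hk; rewrite [in X in (_ < X)%N](cardsD1 e) eH.
rewrite g0 -(expect_avgs (enum T) f) -[LHS]expect_cst.
by apply: eq_expect => H; exact/esym/g0.
Qed.

(* Efron-Stein: averaging out the coordinates one at a time loses
   [p (1 - p) E (influence e (avgs s f))^2] at the coordinate [e], and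
   [influence e] commutes with the averages over the other coordinates. *)
Lemma efron_stein f :
  expect (fun G => f G ^+ 2) - expect f ^+ 2 <=
    p * (1 - p) * \sum_(e : T) expect (fun G => influence e f G ^+ 2).
Proof.
suff main s : uniq s ->
    expect (fun G => f G ^+ 2) - expect (fun G => avgs s f G ^+ 2) <=
    p * (1 - p) * \sum_(e <- s) expect (fun G => influence e f G ^+ 2).
  have := main _ (enum_uniq T).
  rewrite (eq_expect (f := fun G => avgs _ f G ^+ 2) (g := fun=> expect f ^+ 2)); last first.
    by move=> G; rewrite avgs_enum.
  by rewrite expect_cst big_enum.
elim: s => [_|e s IH /= /andP[es us]]; first by rewrite subrr big_nil mulr0.
have pp : 0 <= p * (1 - p) by case/andP: p01 => p0 p1; rewrite mulr_ge0 ?subr_ge0.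
rewrite big_cons mulrDr.
have step : expect (fun G => avgs s f G ^+ 2) - expect (fun G => avg e (avgs s f) G ^+ 2)
    <= p * (1 - p) * expect (fun G => influence e f G ^+ 2).
  rewrite -(expect_avg e (fun G => avgs s f G ^+ 2)) -expectB.
  apply: le_trans (ler_wpM2l pp (expect_avgs_sqr s (influence e f))).
  rewrite -expectZ le_eqVlt; apply/orP; left; apply/eqP; apply: eq_expect => G.
  by rewrite avg_sqr influence_avgs.
have := IH us; lra.
Qed.

End Bernoulli.

(** * Self-avoiding paths and balls *)

Section AvoidingPaths.
Variable T : finType.
Implicit Types (r : rel T) (S : {set T}) (u v a : T) (s t : seq T).

(* [S] collects the vertices already visited, so that the recursive call does
   not depend on the edges at [v]. *)
Fixpoint long r (h : nat) S v : bool :=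
  if h is h'.+1 then
    [exists u, [&& u \notin (v |: S)%SET, r v u & long r h' (v |: S)%SET u]]
  else true.

Fixpoint reach r (k : nat) S a v : bool :=
  (v == a) || if k is k'.+1 then
    [exists u, [&& u \notin (a |: S)%SET, r a u & reach r k' (a |: S)%SET u v]]
  else false.

(** Counts the self-avoiding paths of length at most [k] from [a], the trivial one included. It
    dominates the size of the ball given by [reach], and its recursion is a plain sum over
    neighbours, so its second moment can be bounded by induction. *)
Fixpoint npaths r (k : nat) S a : nat :=
  if k is k'.+1 then
    (1 + \sum_(u | u \notin (a |: S)%SET) r a u * npaths r k' (a |: S)%SET u)%N
  else 1%N.

Lemma longP r h S v :
  reflect (exists s, [/\ size s = h, path r v s, uniq (v :: s) &
                         all (fun x => x \notin S) s])
          (long r h S v).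
Proof.
elim: h S v => [|h IH] S v /=; first by apply: ReflectT; exists [::].
apply: (iffP existsP) => [[u /and3P[uS vu /IH[s [sh us uq sS]]]]|].
  exists (u :: s); move: uS; rewrite !inE negb_or => /andP[uv uS].
  have vs : v \notin s by apply: contraTN sS => vs; apply/allPn; exists v; rewrite // !inE eqxx.
  rewrite /= sh vu us uS ?inE negb_or eq_sym uv vs; split=> //.
  by apply: sub_all sS => x; rewrite !inE negb_or => /andP[].
case=> -[|u s] [] //= [sh] /andP[vu us] /andP[vus uq] /andP[uS sS].
move: vus; rewrite ?inE negb_or => /andP[vu' vs].
exists u; rewrite !inE negb_or eq_sym vu' uS vu /=; apply/IH; exists s.
split=> //; apply/allP => x xs; rewrite !inE negb_or (allP sS) // andbT.
by apply: contraNneq vs => <-.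
Qed.

Lemma reach_last r k S a s : path r a s -> uniq (a :: s) ->
  all (fun x => x \notin S) s -> (size s <= k)%N -> reach r k S a (last a s).
Proof.
elim: k S a s => [|k IH] S a [|u s] //=; rewrite ?eqxx //.
move=> /andP[au us] /andP[aus uq] /andP[uS sS] sk; apply/orP; right.
move: aus; rewrite ?inE negb_or => /andP[au' As].
apply/existsP; exists u; rewrite !inE negb_or eq_sym au' uS au /= IH //.
apply/allP => x xs; rewrite !inE negb_or (allP sS) // andbT.
by apply: contraNneq As => <-.
Qed.

Lemma card_reach r k S a : (#|[set v | reach r k S a v]%SET| <= npaths r k S a)%N.
Proof.
elim: k S a => [|k IH] S a /=.
  by rewrite -(cards1 a) subset_leq_card //; apply/fintype.subsetP => v; rewrite !inE orbF.
pose N u := [set v | reach r k (a |: S)%SET u v]%SET.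
apply: (@leq_trans #|([set a] :|: \bigcup_(u | (u \notin a |: S) && r a u) N u)%SET|).
  apply/subset_leq_card/fintype.subsetP => v; rewrite 3!inE => /orP[/eqP ->|].
    by rewrite eqxx.
  case/existsP => u /and3P[uS au nv]; apply/orP; right.
  by apply/bigcupP; exists u; rewrite ?uS ?au ?inE.
apply: leq_trans (leq_card_setU _ _) _; rewrite cards1 leq_add2l.
apply: leq_trans (unstable.card_big_setU _ _ _) _.
rewrite big_mkcondr /=; apply: leq_sum => u uS.
by case: ifP => _; rewrite ?mul1n ?mul0n // IH.
Qed.

(** The search never uses an edge that meets [S]. As the recursive calls have [v] in their forbidden
    set, they do not change when a pair at [v] is flipped; this is the source of the independence in
    the estimates below. *)
Lemma eq_long r r' h S v : {in [predC S] &, r =2 r'} -> v \notin S ->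
  long r h S v = long r' h S v.
Proof.
elim: h S v => //= h IH S v rr' vS; apply: eq_existsb => u.
case: (boolP (u \in _)) => //= uS.
have uS' : u \notin S by move: uS; rewrite !inE negb_or => /andP[].
rewrite rr' ?inE // (IH (v |: S)%SET) // => x y.
by rewrite !inE !negb_or => /andP[_ xS] /andP[_ yS]; apply: rr'; rewrite inE.
Qed.

Lemma eq_npaths r r' k S a : {in [predC S] &, r =2 r'} -> a \notin S ->
  npaths r k S a = npaths r' k S a.
Proof.
elim: k S a => //= k IH S a rr' aS; congr (_ + _)%N; apply: eq_bigr => u uS.
have uS' : u \notin S by move: uS; rewrite !inE negb_or => /andP[].
rewrite rr' ?inE // (IH (a |: S)%SET) // => x y.
by rewrite !inE !negb_or => /andP[_ xS] /andP[_ yS]; apply: rr'; rewrite inE.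
Qed.

End AvoidingPaths.

(** * Forks and the effect of flipping one pair *)

Section Graphs.
Variable n : nat.
Implicit Types (G : sgraph n) (e : vpair n) (a u v : 'I_n).

Lemma adj_edge a u : a != u ->
  exists2 e : vpair n, val e = [set a; u]%SET & forall G, adj G a u = (e \in G).
Proof.
move=> au; have eP : #|[set a; u]%SET| == 2%N by rewrite cards2 au.
exists (Sub [set a; u]%SET eP) => [|G]; first exact: SubK.
apply/existsP/idP => [[e /andP[eG /eqP eE]]|eG].
  by suff -> : Sub [set a; u]%SET eP = e by []; apply: val_inj; rewrite SubK.
by exists (Sub [set a; u]%SET eP); rewrite eG SubK /=.
Qed.

Lemma adj_flip G e a u :
  val e != [set a; u]%SET -> adj (e |: G)%SET a u = adj (G :\ e)%SET a u.
Proof.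
move=> eE; apply: eq_existsb => x; rewrite !inE.
by case: eqVneq => // ->; rewrite (negbTE eE) !andbF.
Qed.

Lemma adj_setU1 G e a u : a \notin val e -> adj (e |: G)%SET a u = adj (G :\ e)%SET a u.
Proof. by move=> ae; apply: adj_flip; apply: contraNneq ae => ->; rewrite !inE eqxx. Qed.

Lemma adj_flip_in (S : {set 'I_n}) G e x : x \in S -> x \in val e ->
  {in [predC S] &, adj (e |: G)%SET =2 adj (G :\ e)%SET}.
Proof.
move=> xS xe u v; rewrite !inE => uS vS; apply: adj_flip.
by apply: contraTneq xe => ->; rewrite !inE; apply/norP; split;
  apply: contraTneq xS => ->.
Qed.

Lemma sub_adj G (H : sgraph n) : G \subset H -> subrel (adj G) (adj H).
Proof.
move=> /fintype.subsetP GH u v /existsP[e /andP[eG eE]].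
by apply/existsP; exists e; rewrite GH.
Qed.

(** Follow the path from [v] up to its first vertex on [e], which exists since otherwise the path
    would survive without [e]. No earlier step uses [e], so this prefix remains, and read backwards
    it leads from an end of [e] to [v]. *)
Lemma path_flip G e v (s : seq 'I_n) : uniq (v :: s) ->
  path (adj (e |: G)%SET) v s -> ~~ path (adj (G :\ e)%SET) v s ->
  exists2 a, a \in val e & reach (adj G) (size s) finset.set0 a v.
Proof.
move=> uvs vs nvs.
have [s1 [s2 [ss1 v1 e1]]] : exists s1 s2, [/\ s = s1 ++ s2,
    path (adj (G :\ e)%SET) v s1 & last v s1 \in val e].
  elim: s v {uvs} vs nvs => //= u s IH v /andP[vu us].
  have [ve|ve] := boolP (v \in val e); first by exists [::], (u :: s).
  rewrite -(adj_setU1 G u ve) vu /= => nus.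
  have [s1 [s2 [-> u1 e1]]] := IH u us nus.
  by exists (u :: s1), s2; rewrite /= -(adj_setU1 G u ve) vu.
exists (last v s1) => //.
have lastE : last (last v s1) (rev (belast v s1)) = v.
  by case: s1 {ss1 v1 e1} => //= x s1; rewrite rev_cons last_rcons.
rewrite -{2}lastE; apply: reach_last.
- rewrite rev_path (@eq_path _ _ (adj G)); last by move=> x y; rewrite adj_sym.
  by apply: sub_path v1; apply: sub_adj; exact: subD1set.
- rewrite -rev_rcons -lastI rev_uniq; move: uvs.
  by rewrite ss1 -cat_cons cat_uniq => /and3P[].
- by apply/allP => x _; rewrite inE.
- by rewrite size_rev size_belast ss1 size_cat leq_addr.
Qed.

Lemma long_flip h (S : {set 'I_n}) G e v :
  long (adj (e |: G)%SET) h S v != long (adj (G :\ e)%SET) h S v ->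
  exists2 a, a \in val e & reach (adj G) h finset.set0 a v.
Proof.
have sGe : (G :\ e \subset e |: G)%SET.
  by apply: fintype.subset_trans (subD1set _ _) (finset.subsetUr _ _).
case: longP => [[s [sh vs us sS]]|nl]; case: longP => //.
  move=> nl _; rewrite -sh; apply: path_flip vs _ => //.
  by apply/negP => vs; apply: nl; exists s.
case=> s [sh vs us sS] _; case: nl; exists s; split=> //.
by apply: sub_path vs; exact: sub_adj.
Qed.

(** The possible prongs at [v]. Adjacency to [v] is left out, so that membership is independent of
    the edges at [v]. *)
Definition forks G h v : {set 'I_n} :=
  [set u | (u != v) && long (adj G) h [set v]%SET u]%SET.

(** The paths starting at [u] and [u'] may meet: given the graph away from [v], a fork is an event
    about two neighbours of [v] only. *)
Definition fork G h v : bool :=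
  [exists u, exists u', [&& u != u', adj G v u, adj G v u',
    u \in forks G h v & u' \in forks G h v]].

(** If [v] is not on [e], its neighbours stay the same, so some neighbour [u] gains or loses its
    path of length [h]. Prefixing [v] gives a path of length [h.+1] through [e], to which
    [path_flip] applies. *)
Lemma fork_flip h G e v :
  fork (e |: G)%SET h v != fork (G :\ e)%SET h v ->
  exists2 a, a \in val e & reach (adj G) h.+1 finset.set0 a v.
Proof.
have [ve _|ve] := boolP (v \in val e); first by exists v => //=; rewrite eqxx.
move=> ff; suff /existsP[u] : [exists u, [&& u != v, adj (e |: G)%SET v u &
    long (adj (e |: G)%SET) h [set v]%SET u != long (adj (G :\ e)%SET) h [set v]%SET u]].
  case/and3P => uv vu; case: longP => [[s [sh us uq sS]]|nl]; case: longP => //.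
    move=> nl _; have uvs : uniq (v :: u :: s).
      rewrite cons_uniq uq andbT inE eq_sym negb_or uv /=.
      by apply: contraTN sS => vs; apply/allPn; exists v; rewrite // !inE eqxx.
    rewrite -sh; apply: (path_flip (s := u :: s) (e := e)) => //=; first by rewrite vu.
    apply/negP => /andP[_ us']; apply: nl; exists s; split=> //.
  case=> s [sh us uq sS] _; case: nl; exists s; split=> //.
  apply: sub_path us; apply: sub_adj.
  by apply: fintype.subset_trans (subD1set _ _) (finset.subsetUr _ _).
apply: contraR ff; rewrite negb_exists => /forallP ff; apply/eqP.
have fE u : adj (e |: G)%SET v u ->
    (u \in forks (e |: G)%SET h v) = (u \in forks (G :\ e)%SET h v).
  move=> vu; have := ff u; rewrite !inE vu /=.
  by case: eqVneq => //= _ /negPn/eqP ->.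
apply: eq_existsb => u; apply: eq_existsb => u'; rewrite -!(adj_setU1 G _ ve).
have [vu|] := boolP (adj (e |: G)%SET v u); last by rewrite !andbF.
have [vu'|] := boolP (adj (e |: G)%SET v u'); last by rewrite !andbF.
by rewrite !fE.
Qed.

End Graphs.

Lemma sum_ord_cst (R : pzSemiRingType) (n : nat) (c : R) : \sum_(u < n) c = n%:R * c.
Proof. by rewrite sumr_const card_ord mulr_natl. Qed.

(** * Probability that a long path starts at a given vertex *)

Section RandomGraphs.
Variables (R : realFieldType) (n : nat) (p : R).
Hypothesis p01 : 0 <= p <= 1.
Implicit Types (G : sgraph n) (e : vpair n) (a u v : 'I_n) (S : {set 'I_n}).
Implicit Types f : sgraph n -> R.

Local Notation E := (expect p).

Let p0 : 0 <= p. Proof. by case/andP: p01. Qed.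

Definition free_at a f := forall e, a \in val e -> free_of e f.

Lemma expect_adj a u f : a != u -> free_at a f ->
  E (fun G => (adj G a u)%:R * f G) = p * E f.
Proof.
move=> au fa; have [e eE aE] := adj_edge au.
rewrite -(expect_mem _ (fa e _)) ?eE ?inE ?eqxx //.
by apply: eq_expect => G; rewrite aE.
Qed.

Lemma expect_adj2 a u v f : a != u -> a != v -> u != v -> free_at a f ->
  E (fun G => (adj G a u)%:R * ((adj G a v)%:R * f G)) = p ^+ 2 * E f.
Proof.
move=> au av uv fa; have [e eE aE] := adj_edge au; have [e' eE' aE'] := adj_edge av.
have ee' : e != e'.
  apply: contraNneq uv => ee'; have : u \in [set a; v]%SET by rewrite -eE' -ee' eE !inE eqxx orbT.
  by rewrite !inE eq_sym (negbTE au).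
rewrite -(expect_mem2 _ ee' (fa e _) (fa e' _)) ?eE ?eE' ?inE ?eqxx //.
by apply: eq_expect => G; rewrite aE aE'.
Qed.

Lemma expect_no_adj a S f : a \notin S -> free_at a f ->
  E (fun G => (~~ [exists u in S, adj G a u])%:R * f G) = (1 - p) ^+ #|S| * E f.
Proof.
move=> aS fa; pose W := [set e : vpair n | val e \in [set [set a; u] | u in S]]%SET.
have WP e : reflect (exists2 u, u \in S & val e = [set a; u]%SET) (e \in W).
  by rewrite inE; apply: imsetP.
have cW : #|W| = #|S|.
  rewrite -(card_imset (mem W) val_inj).
  have -> : val @: W = [set [set a; u] | u in S]%SET.
    apply/finset.setP => x; apply/imsetP/imsetP => [[e /WP[u uS ->] ->]|[u uS ->]].
      by exists u.
    have au : a != u by apply: contraNneq aS => ->.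
    by have [e eE _] := adj_edge au; exists e => //; apply/WP; exists u.
  apply: card_in_imset => u v uS vS uv.
  have : u \in [set a; v]%SET by rewrite -uv !inE eqxx orbT.
  rewrite !inE => /orP[/eqP ua|/eqP //].
  by rewrite -ua uS in aS.
rewrite -cW -expect_disjoint; last first.
  by move=> e /WP[u _ eE]; apply: fa; rewrite eE !inE eqxx.
apply: eq_expect => G; congr ((nat_of_bool _)%:R * _); apply/idP/idP.
  move=> nadj; apply/pred0P => e /=; apply/negP => /andP[/WP[u uS eE] eG].
  case/negP: nadj; apply/existsP; exists u; rewrite uS.
  by apply/existsP; exists e; rewrite eG eE eqxx.
move=> dW; apply/negP => /existsP[u /andP[uS /existsP[e /andP[eG /eqP eE]]]].
by move/pred0P: dW => /(_ e); rewrite /= eG andbT => /WP; case; exists u.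
Qed.

(** The random set [U G] is decided by the pairs away from [a], so one can condition on its value
    [S] and apply [expect_no_adj]. *)
Lemma expect_exists_adj a (U : sgraph n -> {set 'I_n}) :
    (forall e G, a \in val e -> U (e |: G)%SET = U (G :\ e)%SET) ->
    (forall G, a \notin U G) ->
  E (fun G => [exists u in U G, adj G a u]%:R) = 1 - E (fun G => (1 - p) ^+ #|U G|).
Proof.
move=> Ufree aU.
have -> : E (fun G => (1 - p) ^+ #|U G|) =
    E (fun G => (~~ [exists u in U G, adj G a u])%:R).
  transitivity (E (fun G => \sum_(S : {set 'I_n} | a \notin S)
      (1 - p) ^+ #|S| * (U G == S)%:R)).
    apply: eq_expect => G; rewrite (bigD1 (U G)) //= eqxx mulr1 big1 ?addr0 // => S.
    by rewrite eq_sym => /andP[_ /negbTE ->]; rewrite mulr0.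
  rewrite expect_sum.
  transitivity (\sum_(S : {set 'I_n} | a \notin S)
      E (fun G => (~~ [exists u in S, adj G a u])%:R * (U G == S)%:R)).
    apply: eq_bigr => S aS; rewrite expectZ [RHS]expect_no_adj // => e ae G.
    by rewrite Ufree.
  rewrite -expect_sum; apply: eq_expect => G.
  rewrite (bigD1 (U G)) //= eqxx mulr1 big1 ?addr0 // => S.
  by rewrite eq_sym => /andP[_ /negbTE ->]; rewrite mulr0.
transitivity (E (fun G => 1 - (~~ [exists u in U G, adj G a u])%:R)); last first.
  by rewrite expectB expect_cst.
by apply: eq_expect => G; case: [exists u in U G, adj G a u]; rewrite ?subr0 ?subrr.
Qed.

(** With $y = pm$ this says $(1-p)^m \ge (2-p-y)/(2-p+y)$, an equality for $m = 0$ and $m = 1$; it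
    follows by induction on $m$. *)
Lemma expr_one_sub_ge (m : nat) :
  1 - (1 - p) ^+ m <= 2 * (p * m%:R) / (2 - p + p * m%:R).
Proof.
have p1 : p <= 1 by case/andP: p01.
have pos k : 0 < 2 - p + p * k%:R.
  by have := mulr_ge0 p0 (ler0n R k); lra.
rewrite ler_pdivlMr //.
suff : 2 - p - p * m%:R <= (1 - p) ^+ m * (2 - p + p * m%:R) by nra.
elim: m => [|m IH]; first by rewrite expr0; lra.
set q := (1 - p) ^+ m in IH; set x := p * m%:R in IH.
have x0 : 0 <= x by rewrite mulr_ge0.
have xE : p * m.+1%:R = x + p by rewrite -natr1 mulrDr mulr1.
rewrite exprS -/q xE -(ler_pM2r (pos m)) -/x.
have q1 : 0 <= 1 - p by lra.
have := ler_wpM2l q1 (ler_wpM2r (ltW (pos m.+1)) IH); rewrite xE.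
(* After clearing denominators, this is exactly the slack of the induction step. *)
have : 0 <= x * x * p + x * p * p by rewrite addr_ge0 ?mulr_ge0.
nra.
Qed.

(** Jensen's inequality for the concave bound of [expr_one_sub_ge]. The tangent has nonnegative
    slope, so [t] may be any upper bound on the mean of [p * f]. *)
Lemma expect_sat_le (f : sgraph n -> nat) (t : R) :
    0 <= t -> p * E (fun G => (f G)%:R) <= t ->
  E (fun G => 1 - (1 - p) ^+ f G) <= 2 * t / (2 - p + t).
Proof.
move=> t0 ft; have p1 : p <= 1 by case/andP: p01.
set D := 2 - p; have D0 : 0 < D by rewrite /D; lra.
have Dt : 0 < D + t by lra.
(* Tangent line at [t] of the concave function [z |-> 2 z / (D + z)]. *)
have tangent z : 0 <= z ->
    2 * z / (D + z) <= 2 * t ^+ 2 / (D + t) ^+ 2 + 2 * D / (D + t) ^+ 2 * z.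
  move=> z0; have Dz : 0 < D + z by lra.
  rewrite [2 * D / _ * z]mulrAC -mulrDl ler_pdivrMr // mulrAC ler_pdivlMr ?exprn_gt0 //.
  have : 0 <= D * (t - z) ^+ 2 by rewrite mulr_ge0 ?sqr_ge0 ?ltW.
  nra.
apply: (@le_trans _ _ (2 * t ^+ 2 / (D + t) ^+ 2
    + 2 * D / (D + t) ^+ 2 * (p * E (fun G => (f G)%:R)))).
  rewrite -expectZ -expectZ.
  set c := 2 * t ^+ 2 / _; rewrite -(expect_cst (vpair n) p c) -expectD.
  apply: le_expect => // G; apply: le_trans (expr_one_sub_ge _) _.
  by apply: tangent; rewrite mulr_ge0.
have -> : 2 * t / (D + t) = 2 * t ^+ 2 / (D + t) ^+ 2 + 2 * D / (D + t) ^+ 2 * t.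
  rewrite [2 * D / _ * t]mulrAC -mulrDl; apply/eqP; rewrite eqr_div ?expf_neq0 ?lt0r_neq0 //.
  by apply/eqP; lra.
by rewrite lerD2l ler_wpM2l // divr_ge0 ?exprn_ge0 ?mulr_ge0 // ltW.
Qed.

(** The pairs at [v] are revealed last: the vertices from which the path could continue are decided
    by the remaining pairs, and [v] must be joined to one of them. *)
Lemma expect_longS h S v :
  E (fun G => (long (adj G) h.+1 S v)%:R) =
  E (fun G => 1 - (1 - p) ^+
     #|[set u | (u \notin v |: S) && long (adj G) h (v |: S) u]%SET|).
Proof.
pose U G := [set u | (u \notin v |: S) && long (adj G) h (v |: S) u]%SET.
rewrite expectB expect_cst -(expect_exists_adj (a := v) (U := U)).
- apply: eq_expect => G /=; congr (nat_of_bool _)%:R.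
  by apply: eq_existsb => u; rewrite [in RHS]finset.in_set -andbA; congr (_ && _); rewrite andbC.
- move=> e G ve; apply: finset.eq_finset => u.
  case: (boolP (u \notin _)) => //= uS.
  by apply: eq_long uS; apply: adj_flip_in ve; rewrite !inE eqxx.
- by move=> G; rewrite !inE eqxx.
Qed.

Lemma expect_card (P : sgraph n -> pred 'I_n) :
  E (fun G => #|[set u | P G u]%SET|%:R) = \sum_u E (fun G => (P G u)%:R).
Proof.
rewrite -expect_sum; apply: eq_expect => G; rewrite -natr_sum -sum1_card.
by rewrite big_mkcond; congr (_%:R); apply: eq_bigr => u _; rewrite inE; case: (P G u).
Qed.

Lemma expect_long_le (eps : R) h S v :
    p * n%:R <= 1 + eps -> p <= 2 * eps ^+ 2 -> 0 <= eps -> h%:R * eps <= 1 ->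
  E (fun G => (long (adj G) h S v)%:R) <= 4 / (h%:R + 1).
Proof.
move=> pn p2 e0; elim: h S v => [|h IH] S v he.
  by rewrite (eq_expect p (g := fun=> 1)) // expect_cst add0r divr1 ler1n.
have h0 : 0 <= h%:R :> R by [].
have hS : h.+1%:R = h%:R + 1 :> R by rewrite -natr1.
rewrite hS in he *.
rewrite expect_longS; pose t := (1 + eps) * (4 / (h%:R + 1)).
have t0 : 0 <= t by rewrite mulr_ge0 ?divr_ge0 //; lra.
apply: le_trans (expect_sat_le t0 _) _.
  rewrite expect_card.
  apply: (@le_trans _ _ (p * (n%:R * (4 / (h%:R + 1))))); last first.
    by rewrite /t (mulrA p) ler_wpM2r ?divr_ge0 //; lra.
  rewrite ler_wpM2l // -sum_ord_cst; apply: ler_sum => u _.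
  apply: le_trans (IH (v |: S)%SET u _); last by nra.
  by apply: le_expect => // G; case: (_ \notin _).
have p1 : p <= 1 by case/andP: p01.
rewrite ler_pdivrMr; last by lra.
rewrite mulrAC ler_pdivlMr; last by lra.
(* Multiplied by $h+1$, the goal becomes $4\varepsilon h + 2p(h+1) \le 4$, which follows from
   $(h+1)\varepsilon \le 1$ and $p \le 2\varepsilon^2$. *)
have : t * (h%:R + 1) = 4 * (1 + eps) by rewrite /t mulrCA -mulrA divfK ?mulr1 //; lra.
set x := h%:R in h0 he t t0 *.
nra.
Qed.

End RandomGraphs.

(** * Second moments and concentration of the number of forks *)

Section LocalStatistics.
Variables (R : realFieldType) (n : nat) (p : R).
Hypothesis p01 : 0 <= p <= 1.
Hypothesis pn2 : p * n%:R <= 2.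
Implicit Types (G : sgraph n) (e : vpair n) (a u v : 'I_n) (S : {set 'I_n}).

Local Notation E := (expect p).

Let p0 : 0 <= p. Proof. by case/andP: p01. Qed.

(** Write the count as $1 + x$ with $x$ a sum over neighbours. Expanding $x^2$, equal indices cost
    one edge and distinct ones two, so $E x^2 \le (pn + (pn)^2) 14^k \le 6 \cdot 14^k$; then
    $(1+x)^2 \le 2 + 2x^2$ gives the factor 14. *)
Lemma expect_npaths_sqr k S a : a \notin S ->
  E (fun G => (npaths (adj G) k S a)%:R ^+ 2) <= 14 ^+ k.
Proof.
elim: k S a => [|k IH] S a aS.
  by rewrite (eq_expect p (g := fun=> 1)) ?expect_cst // => G; rewrite expr1n.
pose Z u (G : sgraph n) : R := (npaths (adj G) k (a |: S)%SET u)%:R.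
pose P u := u \notin (a |: S)%SET.
pose x G : R := \sum_(u | P u) (adj G a u)%:R * Z u G.
have Zfree u : P u -> free_at a (Z u).
  move=> uS e ae G; congr _%:R; apply: eq_npaths uS.
  by apply: adj_flip_in ae; rewrite !inE eqxx.
have EZ u : P u -> E (fun G => Z u G ^+ 2) <= 14 ^+ k by exact: IH.
have aP u : P u -> a != u by apply: contraNneq => <-; rewrite !inE eqxx.
set b : R := 14 ^+ k in EZ *; have b0 : 0 <= b by rewrite exprn_ge0.
have Ex : E (fun G => x G ^+ 2) <= 6 * b.
  have -> : E (fun G => x G ^+ 2) = \sum_(u | P u) \sum_(v | P v)
      E (fun G => (adj G a u)%:R * ((adj G a v)%:R * (Z u G * Z v G))).
    rewrite (eq_expect p (g := fun G => \sum_(u | P u) \sum_(v | P v)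
      (adj G a u)%:R * ((adj G a v)%:R * (Z u G * Z v G)))).
      by rewrite expect_sum; apply: eq_bigr => u _; rewrite expect_sum.
    move=> G; rewrite expr2 /x big_distrlr /=.
    by apply: eq_bigr => u _; apply: eq_bigr => v _; lra.
  apply: (@le_trans _ _ (\sum_(u < n) \sum_(v < n) ((u == v)%:R * p * b + p ^+ 2 * b))).
    rewrite big_mkcond /=; apply: ler_sum => u _; case: ifP => Pu; last first.
      by apply: sumr_ge0 => v _; rewrite addr_ge0 ?mulr_ge0 ?sqr_ge0.
    rewrite big_mkcond /=; apply: ler_sum => v _; case: ifP => Pv; last first.
      by rewrite addr_ge0 ?mulr_ge0 ?sqr_ge0.
    have [<-|uv] := eqVneq u v.
      rewrite mul1r; apply: (@le_trans _ _ (p * b)); last first.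
        by rewrite lerDl mulr_ge0 ?sqr_ge0.
      rewrite (eq_expect p (g := fun G => (adj G a u)%:R * Z u G ^+ 2)); last first.
        by move=> G; case: (adj G a u); rewrite ?mul1r ?mul0r.
      rewrite expect_adj ?aP //; first by rewrite ler_wpM2l ?EZ.
      by move=> e ae G; rewrite Zfree.
    rewrite mul0r mul0r add0r expect_adj2 ?aP //; last first.
      by move=> e ae G; rewrite (Zfree u) ?(Zfree v).
    rewrite ler_wpM2l ?sqr_ge0 //.
    apply: (@le_trans _ _ (E (fun G => 2^-1 * (Z u G ^+ 2 + Z v G ^+ 2)))).
      by apply: le_expect => // G; have := sqr_ge0 (Z u G - Z v G); set z := Z u G; set z' := Z v G; lra.
    by rewrite expectZ expectD; have := EZ _ Pu; have := EZ _ Pv; lra.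
  under eq_bigr => u _.
    rewrite big_split /= sum_ord_cst (bigD1 u) //= eqxx mul1r big1 ?addr0; last first.
      by move=> v /negbTE; rewrite eq_sym => ->; rewrite !mul0r.
    over.
  rewrite sum_ord_cst; set N : R := n%:R; have N0 : 0 <= N by [].
  have pN0 : 0 <= p * N by rewrite mulr_ge0.
  have -> : N * (p * b + N * (p ^+ 2 * b)) = (p * N + (p * N) ^+ 2) * b by lra.
  by rewrite ler_wpM2r //; have := pn2; rewrite -/N; nra.
have step : E (fun G => (npaths (adj G) k.+1 S a)%:R ^+ 2) <=
    E (fun G => 2 + 2 * x G ^+ 2).
  apply: le_expect => // G.
  have -> : (npaths (adj G) k.+1 S a)%:R = 1 + x G.
    by rewrite /= natrD natr_sum; congr (_ + _); apply: eq_bigr => u _; rewrite natrM.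
  by have := sqr_ge0 (x G - 1); nra.
apply: le_trans step _; rewrite expectD expectZ expect_cst exprS -/b.
have b1 : 1 <= b by rewrite exprn_ege1 // ler1n.
lra.
Qed.

Lemma card_vpair : (#|{: vpair n}| <= n ^ 2)%N.
Proof.
rewrite /vpair card_sig.
have := card_draws 'I_n 2; rewrite card_ord cardsE => cE.
rewrite (eq_card (B := [pred A : {set 'I_n} | #|A| == 2%N])) // cE bin2.
by rewrite leq_half_double leqW // -mulnn -addnn (leq_trans (leq_mul (leqnn _) (leq_pred _))) ?leq_addr.
Qed.

(* Flipping the pair [e] only affects the vertices within distance [k] of [e],
   so [efron_stein] bounds the variance by a sum of ball sizes squared. *)
Lemma variance_local k (P : sgraph n -> pred 'I_n) :
    (forall G e v, P (e |: G)%SET v != P (G :\ e)%SET v ->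
       exists2 a, a \in val e & reach (adj G) k finset.set0 a v) ->
  E (fun G => #|[set v | P G v]%SET|%:R ^+ 2) - E (fun G => #|[set v | P G v]%SET|%:R) ^+ 2
    <= 8 * 14 ^+ k * n%:R.
Proof.
move=> Ploc; pose f G : R := #|[set v | P G v]%SET|%:R.
change (E (fun G => f G ^+ 2) - E f ^+ 2 <= 8 * 14 ^+ k * n%:R).
pose N a (G : sgraph n) : R := (npaths (adj G) k finset.set0 a)%:R.
have influence_le e G : influence e f G ^+ 2 <= 2 * \sum_(a in val e) N a G ^+ 2.
  have /cards2P[a [b [ab eE]]] : #|val e| == 2%N := valP e.
  rewrite eE big_setU1 ?big_set1 ?inE //=.
  have dle : `|influence e f G| <= N a G + N b G.
    rewrite /influence /f /N -natrD.
    set A1 := [set v | P _ v]%SET; set A2 := [set v | P (G :\ e)%SET v]%SET.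
    set B := ([set v | reach (adj G) k finset.set0 a v] :|: [set v | reach (adj G) k finset.set0 b v])%SET.
    have BN : (#|B| <= npaths (adj G) k finset.set0 a + npaths (adj G) k finset.set0 b)%N.
      by apply: leq_trans (leq_card_setU _ _) _; rewrite leq_add ?card_reach.
    have AB v : P (e |: G)%SET v != P (G :\ e)%SET v -> v \in B.
      case/Ploc => c; rewrite eE !inE => /orP[/eqP ->|/eqP ->] -> //.
      by rewrite orbT.
    have inA1 v : (v \in A1) = P (e |: G)%SET v by rewrite finset.in_set.
    have inA2 v : (v \in A2) = P (G :\ e)%SET v by rewrite finset.in_set.
    have A12 : (#|A1| <= #|A2| + #|B|)%N.
      apply: leq_trans (leq_card_setU A2 B); apply/subset_leq_card/fintype.subsetP => v.
      rewrite finset.in_setU inA1 inA2 => P1; case: (boolP (P (G :\ e)%SET v)) => //= P2.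
      by apply: AB; rewrite P1 (negbTE P2).
    have A21 : (#|A2| <= #|A1| + #|B|)%N.
      apply: leq_trans (leq_card_setU A1 B); apply/subset_leq_card/fintype.subsetP => v.
      rewrite finset.in_setU inA1 inA2 => P1; case: (boolP (P (e |: G)%SET v)) => //= P2.
      by apply: AB; rewrite P1 (negbTE P2).
    rewrite ler_norml lerBrDl lerBlDl addrC -natrD.
    have := leq_trans A12 (leq_add (leqnn _) BN); have := leq_trans A21 (leq_add (leqnn _) BN).
    by rewrite -!(ler_nat R) !natrD => ? ?; apply/andP; split; lra.
  rewrite -real_normK ?num_real //.
  have := sqr_ge0 (N a G - N b G); have := normr_ge0 (influence e f G).
  have : 0 <= N a G by []. have : 0 <= N b G by [].
  move: (`|_|) dle => d; nra.
apply: le_trans (efron_stein p01 f) _.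
set b : R := 14 ^+ k; have b0 : 0 <= b by rewrite exprn_ge0.
have Ed e : E (fun G => influence e f G ^+ 2) <= 4 * b.
  apply: le_trans (le_expect p01 (influence_le e)) _.
  rewrite expectZ expect_sum.
  apply: (@le_trans _ _ (2 * \sum_(a in val e) b)).
    rewrite ler_wpM2l //; apply: ler_sum => a _.
    by apply: expect_npaths_sqr; rewrite inE.
  by rewrite sumr_const (eqP (valP e)); lra.
have p1 : p <= 1 by case/andP: p01.
have p1p : 0 <= p * (1 - p) by rewrite mulr_ge0 // subr_ge0.
(* There are at most $n^2$ pairs, each with mean squared influence at most $4b$; one factor $pn \le
   2$ then leaves $8bn$. *)
apply: (@le_trans _ _ (p * (1 - p) * (n%:R ^+ 2 * (4 * b)))).
  rewrite ler_wpM2l //.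
  apply: (@le_trans _ _ (\sum_(e : vpair n) 4 * b)); first exact: ler_sum.
  rewrite sumr_const -[leLHS]mulr_natl ler_wpM2r ?mulr_ge0 // -natrX ler_nat.
  exact: card_vpair.
have N0 : 0 <= n%:R :> R by [].
set N' : R := n%:R in N0 *; have := pn2; rewrite -/N' => pN.
have : p * (1 - p) <= p by nra.
have X0 : 0 <= 4 * (b * N') by rewrite !mulr_ge0.
have : p * N' * (4 * (b * N')) <= 2 * (4 * (b * N')) by rewrite ler_wpM2r.
have : p * (1 - p) * (N' ^+ 2 * (4 * b)) <= p * (N' ^+ 2 * (4 * b)).
  by rewrite ler_wpM2r ?mulr_ge0 ?sqr_ge0 //; nra.
lra.
Qed.

(** A fork needs two prongs, and the events that two given vertices are prongs are dependent. The
    second moment is therefore bounded by the squared mean plus the variance from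
    [variance_local]. *)
Lemma expect_forks_sqr h v (q : R) : 0 <= q ->
    (forall u, E (fun G => (long (adj G) h [set v]%SET u)%:R) <= q) ->
  E (fun G => #|forks G h v|%:R ^+ 2) <= (n%:R * q) ^+ 2 + 8 * 14 ^+ h * n%:R.
Proof.
move=> q0 hq.
have var : E (fun G => #|forks G h v|%:R ^+ 2) - E (fun G => #|forks G h v|%:R) ^+ 2
    <= 8 * 14 ^+ h * n%:R.
  apply: (variance_local (P := fun G u => (u != v) && long (adj G) h [set v]%SET u)).
  by move=> G e u; case: (u != v) => //=; exact: long_flip.
have m0 : 0 <= E (fun G => #|forks G h v|%:R) by apply: expect_ge0.
suff : E (fun G => #|forks G h v|%:R) <= n%:R * q.
  move=> mq; have : E (fun G => #|forks G h v|%:R) ^+ 2 <= (n%:R * q) ^+ 2.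
    by rewrite lerXn2r ?nnegrE ?mulr_ge0.
  lra.
rewrite expect_card -sum_ord_cst; apply: ler_sum => u _.
apply: le_trans (hq u); apply: le_expect => // G.
by case: (u != v).
Qed.

(** A fork yields at least two ordered pairs of distinct adjacent prongs, hence the factor 2. Each
    pair needs two edges at [v], independent of prong membership; adding the diagonal terms
    completes the square. *)
Lemma expect_fork_le h v : 2 * E (fun G => (fork G h v)%:R) <=
  p ^+ 2 * E (fun G => #|forks G h v|%:R ^+ 2).
Proof.
pose I u G : R := (u \in forks G h v)%:R.
pose A u u' G : R := (adj G v u)%:R * ((adj G v u')%:R * (I u G * I u' G)).
have Ifree u : free_at v (I u).
  move=> e ve G; rewrite /I !inE; case: (boolP (u != v)) => //= uv.
  congr ((nat_of_bool _)%:R); apply: eq_long; last by rewrite inE.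
  by apply: adj_flip_in ve; rewrite inE.
apply: (@le_trans _ _ (E (fun G => \sum_u \sum_(u' | u != u') A u u' G))).
  rewrite -expectZ; apply: le_expect => // G.
  have A0 u u' : 0 <= A u u' G by rewrite !mulr_ge0.
  have s0 u : 0 <= \sum_(u' | u != u') A u u' G by apply: sumr_ge0.
  rewrite /fork; case: existsP => [[u /existsP[u' /and5P[uu' vu vu' fu fu']]]|_]; last first.
    by rewrite mulr0 sumr_ge0.
  rewrite mulr1 (bigD1 u) //= (bigD1 u' (P := fun w => w != u)) 1?eq_sym //=.
  rewrite (bigD1 u' (P := fun w => u != w)) //= (bigD1 u (P := fun w => u' != w)) 1?eq_sym //=.
  have -> : A u u' G = 1 by rewrite /A /I vu vu' fu fu' !mulr1.
  have -> : A u' u G = 1 by rewrite /A /I vu vu' fu fu' !mulr1.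
  set x := \sum_(_ | _) _; set y := \sum_(_ | _) _; set z := \sum_(_ | _) _.
  have x0 : 0 <= x by apply: sumr_ge0.
  have y0 : 0 <= y by apply: sumr_ge0.
  have z0 : 0 <= z by apply: sumr_ge0.
  lra.
rewrite expect_sum.
apply: (@le_trans _ _ (\sum_u \sum_u' p ^+ 2 * E (fun G => I u G * I u' G))).
  apply: ler_sum => u _; rewrite expect_sum big_mkcond; apply: ler_sum => u' _.
  have pI : 0 <= p ^+ 2 * E (fun G => I u G * I u' G).
    by rewrite mulr_ge0 ?sqr_ge0 // expect_ge0 // => G; rewrite mulr_ge0.
  case: ifP => // uu'.
  have [uv|uv] := eqVneq u v.
    rewrite (eq_expect p (g := fun=> 0)) ?expect_cst // => G.
    by rewrite /A /I inE uv eqxx /= !(mul0r, mulr0).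
  have [uv'|uv'] := eqVneq u' v.
    rewrite (eq_expect p (g := fun=> 0)) ?expect_cst // => G.
    by rewrite /A /I [u' \in _]inE uv' eqxx /= !(mul0r, mulr0).
  rewrite expect_adj2 // 1?eq_sym // => e ve G; rewrite (Ifree u) ?(Ifree u') //.
rewrite le_eqVlt; apply/orP; left; apply/eqP.
rewrite -expectZ; under eq_bigr => u _ do under eq_bigr => u' _ do rewrite -expectZ.
under eq_bigr => u _ do rewrite -expect_sum.
rewrite -expect_sum; apply: eq_expect => G.
under eq_bigr => u _ do rewrite -mulr_sumr.
rewrite -mulr_sumr; congr (_ * _).
have -> : #|forks G h v|%:R = \sum_u I u G.
  by rewrite -sum1_card natr_sum big_mkcond; apply: eq_bigr => u _; rewrite /I; case: ifP.
by rewrite expr2 big_distrlr.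
Qed.

Lemma prob_many_forks (eps : R) h :
    0 < eps < 10^-1 -> p * n%:R = 1 + eps -> p <= 2 * eps ^+ 2 ->
    h%:R * eps <= 1 -> 1 <= h.+1%:R * eps ->
    8 * 14 ^+ h.+1 <= eps ^+ 2 * n%:R ->
  E (fun G => (12 * eps ^+ 2 * n%:R <= #|[set v | fork G h v]%SET|%:R)%R%:R) <=
    8 * 14 ^+ h.+1 / (eps ^+ 4 * n%:R).
Proof.
move=> /andP[e0 e1] pn p2 he he1; set K : R := 8 * 14 ^+ h.+1 => Kn.
set N : R := n%:R in pn Kn *.
have K0 : 0 < K by rewrite mulr_gt0 ?exprn_gt0.
have N0 : 0 < N by have := sqr_ge0 eps; nra.
have hS : h.+1%:R = h%:R + 1 :> R by rewrite -natr1.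
have qle : 4 / (h%:R + 1) <= 4 * eps.
  rewrite -hS ler_pdivrMr ?ltr0n // -mulrA ler_peMr //; lra.
(* The main term is $\frac12 (1+\varepsilon)^2 (4\varepsilon)^2 \le 10\varepsilon^2$, by
   $(1+\varepsilon)^2 \le 5/4$. *)
have fork_le v : E (fun G => (fork G h v)%:R) <= 10 * eps ^+ 2 + K / N.
  have := expect_fork_le h v.
  have fs : E (fun G => #|forks G h v|%:R ^+ 2) <= (N * (4 * eps)) ^+ 2 + K * N.
    have e40 : 0 <= 4 * eps by lra.
    apply: le_trans (expect_forks_sqr (h := h) (v := v) e40 _) _.
      move=> u; apply: le_trans qle; apply: (expect_long_le p01 (eps := eps)) => //; lra.
    rewrite -/N lerD2l ler_wpM2r ?(ltW N0) // /K exprS.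
    have : 0 <= 14 ^+ h :> R by rewrite exprn_ge0.
    lra.
  have := ler_wpM2l (sqr_ge0 p) fs.
  have -> : p ^+ 2 * ((N * (4 * eps)) ^+ 2 + K * N) =
     (p * N) ^+ 2 * (16 * eps ^+ 2) + (p * N) ^+ 2 * (K / N).
    have cN : K / N * N = K by rewrite divfK ?gt_eqF.
    by rewrite -{1}cN; lra.
  rewrite pn; set c := K / N; have c0 : 0 <= c by rewrite divr_ge0 ?ltW.
  have : (1 + eps) ^+ 2 <= 5/4 by nra.
  have := sqr_ge0 eps; nra.
(* Summing over [v] turns the error into [K], which is at most $\varepsilon^2 n$. *)
have mu : E (fun G => #|[set v | fork G h v]%SET|%:R) <= 11 * eps ^+ 2 * N.
  rewrite expect_card.
  apply: (@le_trans _ _ (\sum_(v < n) (10 * eps ^+ 2 + K / N))).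
    by apply: ler_sum => v _; exact: fork_le.
  rewrite sum_ord_cst -/N mulrDr [N * (K / N)]mulrC divfK ?gt_eqF //; lra.
have e2N : 0 < eps ^+ 2 * N by rewrite mulr_gt0 ?exprn_gt0.
apply: le_trans (chebyshev_expect p01 _) _; first by rewrite -/N; lra.
have var := variance_local (k := h.+1) (P := fun G v => fork G h v) (@fork_flip n h).
rewrite /= -/N -/K in var.
rewrite ler_pdivrMr ?exprn_gt0 //; last by lra.
rewrite mulrAC ler_pdivlMr ?mulr_gt0 ?exprn_gt0 //.
set V := _ - _ in var *.
set m := E _ in mu V var *.
(* The threshold exceeds the mean by at least $\varepsilon^2 n$, and the variance is at most
   $Kn$. *)
have d : (eps ^+ 2 * N) ^+ 2 <= (12 * eps ^+ 2 * N - m) ^+ 2.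
  by rewrite lerXn2r ?nnegrE; lra.
have e4N : 0 <= eps ^+ 4 * N by rewrite mulr_ge0 ?exprn_ge0 // ltW.
have := ler_wpM2l (ltW K0) d; have := ler_wpM2r e4N var.
lra.
Qed.

End LocalStatistics.

(** * Most vertices of a long path are forks *)

Section LongPathsFork.
Variables (n : nat) (G : sgraph n) (h : nat).
Implicit Types (u v : 'I_n) (s : seq 'I_n).

Lemma path_forks v u s : path (adj G) v (u :: s) -> uniq (v :: u :: s) ->
  (h <= size s)%N -> adj G v u /\ u \in forks G h v.
Proof.
move=> /andP[vu us] /= /andP[]; rewrite inE negb_or => /andP[vu' vs] /andP[nus uqs] hs.
split=> //; rewrite inE eq_sym vu'; apply/longP; exists (take h s); split.
- by rewrite size_takel.
- exact: take_path.
- by rewrite /= take_uniq // andbT; apply: contra nus; exact: mem_take.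
- by apply/allP => x xs; rewrite inE; apply: contraNneq vs => <-; exact: mem_take xs.
Qed.

(** The prongs are the two neighbours of [v] on the path, the left part being read backwards. Each
    side needs [h.+1] vertices: the prong and [h] more. *)
Lemma fork_inside v s1 s2 : is_path G (s1 ++ v :: s2) ->
  (h < size s1)%N -> (h < size s2)%N -> fork G h v.
Proof.
case/and3P => _ us ps h1 h2.
have p2 : path (adj G) v s2 by case/cat_sorted2: ps.
have u2 : uniq (v :: s2) by move: us; rewrite cat_uniq => /and3P[].
have p1 : path (adj G) v (rev s1).
  rewrite -[path _ _ _]/(sorted (adj G) (v :: rev s1)) -rev_rcons rev_sorted.
  move: ps; rewrite -cat_rcons => /cat_sorted2[+ _]; apply: sub_sorted.
  by move=> x y; rewrite adj_sym.
have u1 : uniq (v :: rev s1).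
  rewrite -rev_rcons rev_uniq; move: us.
  by rewrite -cat_rcons cat_uniq => /and3P[].
have d12 : ~~ has (mem s1) s2.
  by move: us; rewrite cat_uniq /= negb_or => /and3P[_ /andP[]].
move: h1 h2 p1 p2 u1 u2 d12; rewrite -(size_rev s1) -(eq_has (mem_rev s1)).
case: (rev s1) => // x t1; case: s2 {us ps} => // y t2.
rewrite /= !ltnS => h1 h2 p1 p2 u1 u2 /norP[yx _].
have [vx fx] := path_forks p1 u1 h1; have [vy fy] := path_forks p2 u2 h2.
apply/existsP; exists x; apply/existsP; exists y.
rewrite vx vy fx fy !andbT; apply: contraNneq yx => ->.
by rewrite inE eqxx.
Qed.

(** Only the first and last [h.+1] vertices can fail to be forks, and $2(h+1)$ is at most one
    thirteenth of the size. *)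
Lemma count_fork s : is_path G s -> (26 * h.+1 <= size s)%N ->
  (12 * size s <= 13 * count (fork G h) s)%N.
Proof.
move=> ps hs; have hs2 : (h.+1 <= size s - h.+1)%N by lia.
have sE : s = take h.+1 s ++ take (size s - h.+1 - h.+1) (drop h.+1 s) ++
    drop (size s - h.+1 - h.+1) (drop h.+1 s) by rewrite !cat_take_drop.
move: sE (size_drop h.+1 s); set A := take h.+1 s; set M := take _ _; set B := drop _ (drop _ _).
move=> sE sd; have sA : size A = h.+1 by rewrite size_takel //; lia.
have sM : size M = (size s - h.+1 - h.+1)%N by rewrite size_takel // sd leq_subr.
have sB : size B = h.+1 by rewrite size_drop sd; lia.
have Mfork : all (fork G h) M.
  apply/allP => v vM; move: ps; rewrite sE.
  case/splitPr: vM => m1 m2; rewrite -catA /= catA => ps.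
  by apply: fork_inside ps _ _; rewrite size_cat ?sA ?sB; lia.
have : (size M <= count (fork G h) s)%N.
  by rewrite sE !count_cat -(eqP (etrans (esym (all_count _ _)) Mfork)) addnCA leq_addr.
lia.
Qed.

(** By disjointness the concatenation of the paths has no repetition, so the counts for single paths
    add up. *)
Lemma card_fork (F : seq (seq 'I_n)) : disjoint_paths G F ->
    (forall s, s \in F -> (26 * h.+1 <= size s)%N) ->
  (12 * #|covered_vertices F| <= 13 * #|[set v | fork G h v]%SET|)%N.
Proof.
move=> /andP[Fp Fd] Fs.
have [uF cF] : uniq (flatten F) /\
    (12 * size (flatten F) <= 13 * count (fork G h) (flatten F))%N.
  elim: F Fp Fd Fs => //= s F IH /andP[ps pF] /andP[dsF dF] Fs.
  have [uF cF] := IH pF dF (fun t tF => Fs t (mem_behead (s := s :: F) tF)).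
  rewrite size_cat count_cat cat_uniq uF andbT; split; last first.
    by have := count_fork ps (Fs s (mem_head _ _)); lia.
  case/and3P: (ps) => _ -> _ /=; apply/hasPn => v /flattenP[t tF vt].
  by have := allP dsF t tF; rewrite disjoint_sym => /disjointFr -> .
have -> : covered_vertices F = [set v in flatten F]%SET.
  apply/finset.setP => v; rewrite !inE; apply/hasP/flattenP => -[s sF vs];
  by exists s.
rewrite cardsE (card_uniqP uF); apply: leq_trans cF _.
rewrite leq_mul2l -size_filter -(card_uniqP (filter_uniq _ uF)) /=.
by apply/subset_leq_card/fintype.subsetP => v; rewrite mem_filter inE => /andP[].
Qed.

End LongPathsFork.

(** * Transfer to the binomial random graph and conclusion *)

Lemma gnp_probE (R : realType) (n : nat) (p : R) (A : sgraph n -> Prop) :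
  gnp_prob p A = expect p (fun G => `[< A G >]%:R).
Proof.
rewrite /gnp_prob /expect big_mkcond; apply: eq_bigr => G _.
by case: asboolP => _; rewrite ?mulr1 ?mulr0.
Qed.

Lemma gnp_prob_compl (R : realType) (n : nat) (p : R) (A : sgraph n -> Prop) :
  gnp_prob p (fun G => ~ A G) = 1 - gnp_prob p A.
Proof.
rewrite !gnp_probE -{2}(expect_cst (vpair n) p 1) -expectB; apply: eq_expect => G.
by rewrite asbool_neg; case: asboolP => _; rewrite ?subrr ?subr0.
Qed.

Lemma long_paths_cover_fork (R : realType) (n h : nat) (G : sgraph n) (l m : R) :
    26 * h.+1%:R <= l -> long_paths_cover G l (13 * m) ->
  12 * m <= #|[set v | fork G h v]%SET|%:R.
Proof.
move=> hl [F [Fd Fl Fm]].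
have Fs s : s \in F -> (26 * h.+1 <= size s)%N.
  move=> /Fl /(le_trans hl); rewrite -natrM ler_nat => hs.
  exact: leq_trans hs (leq_pred _).
have := card_fork Fd Fs; rewrite -(ler_nat R) !natrM; lra.
Qed.

Theorem theorem2 (R : realType) :
  exists C eps0 : R, 0 < C /\ 0 < eps0 /\
    forall eps : R, 0 < eps < eps0 ->
      gnp_whp (fun n : nat => (1 + eps) / n%:R)
        (fun (n : nat) (G : sgraph n) =>
          ~ long_paths_cover G (C / eps * ln (1 / eps)) (13 * eps ^+ 2 * n%:R)).
Proof.
have ln10 : 0 < ln (10 : R) by rewrite ln_gt0 // ltr1n.
(* For $\varepsilon < 1/10$ one has $\ln(1/\varepsilon) \ge \ln 10$, so the paths have length at
   least $40/\varepsilon$. This exceeds $26(h+1) \le 26/\varepsilon + 26 \le 28.6/\varepsilon$. *)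
exists (40 / ln 10), 10^-1; split; first by rewrite divr_gt0.
split; first by rewrite invr_gt0.
move=> eps /andP[e0 e1].
have ie0 : 0 < eps^-1 by rewrite invr_gt0.
have ie10 : 10 <= eps^-1.
  by rewrite -[10]invrK lef_pV2 ?posrE ?invr_gt0 // ltW.
pose h := Num.truncn eps^-1.
have /andP[h1 h2] : h%:R <= eps^-1 < h.+1%:R by apply: truncn_itv; exact: ltW.
have he : h%:R * eps <= 1 by rewrite -ler_pdivlMr // div1r.
have he1 : 1 <= h.+1%:R * eps by rewrite -ler_pdivrMr // div1r ltW.
have hl : 26 * h.+1%:R <= 40 / ln 10 / eps * ln (1 / eps).
  apply: (@le_trans _ _ (40 * eps^-1)); first by rewrite -natr1; lra.
  have -> : 40 / ln 10 / eps * ln (1 / eps) = 40 * eps^-1 * (ln eps^-1 / ln 10).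
    by rewrite div1r; lra.
  rewrite ler_peMr ?mulr_ge0 ?(ltW ie0) // ler_pdivlMr // mul1r.
  by rewrite ler_ln ?posrE.
set K : R := 8 * 14 ^+ h.+1.
have K8 : 8 <= K by rewrite ler_peMr // exprn_ege1 // ler1n.
(* As [K] is at least 8, this lower bound on [n] also forces $p \le 1$ and $p \le
   2\varepsilon^2$. *)
have prob_le n : K / eps ^+ 2 <= n%:R ->
    `|1 - gnp_prob ((1 + eps) / n%:R) (fun G : sgraph n =>
        ~ long_paths_cover G (40 / ln 10 / eps * ln (1 / eps)) (13 * eps ^+ 2 * n%:R))|
      <= K / (eps ^+ 4 * n%:R).
  have e20 : 0 < eps ^+ 2 by rewrite exprn_gt0.
  rewrite ler_pdivrMr // mulrC => Kn; set N : R := n%:R in Kn *.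
  have N0 : 0 < N by nra.
  set p := (1 + eps) / N.
  have pN : p * N = 1 + eps by rewrite divfK ?gt_eqF.
  have p01 : 0 <= p <= 1.
    by apply/andP; split; [apply: divr_ge0; lra|rewrite ler_pdivrMr //; nra].
  have p2 : p <= 2 * eps ^+ 2 by rewrite ler_pdivrMr //; lra.
  rewrite gnp_prob_compl opprB addrCA subrr addr0 gnp_probE.
  rewrite ger0_norm; last by apply: expect_ge0.
  have pN2 : p * N <= 2 by lra.
  have e01 : 0 < eps < 10^-1 by rewrite e0.
  apply: le_trans (prob_many_forks p01 pN2 e01 pN p2 he he1 Kn).
  apply: le_expect => // G; case: asboolP => // cov.
  suff -> : 12 * eps ^+ 2 * n%:R <= #|[set v | fork G h v]%SET|%:R by [].
  by rewrite -mulrA; apply: long_paths_cover_fork hl _; rewrite mulrA.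
(* [K] depends on [eps] alone, so the bound is $O(1/n)$. *)
apply/cvgrPdist_le => d d0; near=> n.
have nK : K / eps ^+ 2 <= n%:R by near: n; exact: nbhs_infty_ger.
have nd : K / eps ^+ 4 / d <= n%:R by near: n; exact: nbhs_infty_ger.
apply: le_trans (prob_le n nK) _.
have e4 : 0 < eps ^+ 4 by rewrite exprn_gt0.
have n0 : 0 < n%:R :> R by apply: lt_le_trans nK; rewrite divr_gt0 ?exprn_gt0; lra.
by move: nd; rewrite !ler_pdivrMr ?mulr_gt0 //; lra.
Unshelve. all: by end_near.
Qed.
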